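(* Let $p$ be a prime, $f \in \mathbb{Z}[x]$, and $n$ a positive integer. Then $D_f(n) \le D_{pf}(n) \le p\, D_f(n)$, where $pf$ denotes the polynomial $x \mapsto p f(x)$.
   Context: For $g \in \mathbb{Z}[x]$ and $n \in \mathbb{Z}^{+}$, the discriminator $D_g(n)$ is the smallest positive integer $m$ such that $g(1), g(2), \ldots, g(n)$ are pairwise distinct modulo $m$; if no such $m$ exists, $D_g(n) = \infty$. *)

(* Defs.v *)
From mathcomp Require Import all_boot all_order all_algebra.
From mathcomp Require Import boolp constructive_ereal.

Set Implicit Arguments.
Unset Strict Implicit.
Unset Printing Implicit Defensive.

Import Order.TTheory GRing.Theory Num.Theory.
Local Open Scope ring_scope.

Definition discriminates (g : {poly int}) (n m : nat) : bool :=
  (0 < m)%N && uniq [seq (g.[i%:Z] %% m%:Z)%Z | i <- iota 1 n].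

(* The values live in \bar int so as to use the library's order and
   multiplication on extended numbers; only positive integers and +oo occur. *)
Definition discriminator (g : {poly int}) (n : nat) : \bar int :=
  if pselect (exists m, discriminates g n m) is left ex_m
  then ((ex_minn ex_m)%:Z)%:E
  else +oo%E.

(* Main.v *)
Require Import Defs.
From mathcomp Require Import all_boot all_order all_algebra.
From mathcomp Require Import boolp constructive_ereal.

Set Implicit Arguments.
Unset Strict Implicit.
Unset Printing Implicit Defensive.

Import Order.TTheory GRing.Theory Num.Theory.
Local Open Scope ring_scope.

(** A modulus separating the values of [p f] separates those of [f], and if [m] separates those of
    [f] then [p * m] separates those of [p f]. In each inequality, take the modulus attaining the
    larger side: it yields a competitor for the minimum on the smaller side. If there is none, that
    side is infinite. *)

Lemma discriminates_unscale (p : nat) (f : {poly int}) (n m : nat) :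
  discriminates (p%:Z *: f) n m -> discriminates f n m.
Proof.
case/andP=> m_gt0 pf_uniq; rewrite /discriminates m_gt0 /=.
(* The residue of [p * a] mod [m] depends only on that of [a], so a collision for [f] would survive
   scaling. *)
apply: (@map_uniq _ _ (fun a : int => (p%:Z * a %% m%:Z)%Z)).
rewrite -map_comp; congr (uniq _): pf_uniq.
by apply: eq_map => i /=; rewrite hornerZ modzMmr.
Qed.

(** Reducing [p * a] mod [p * m] gives [p] times the residue of [a] mod [m], and multiplication by
    [p] is injective on integers. *)
Lemma discriminates_scale (p : nat) (f : {poly int}) (n m : nat) :
  (0 < p)%N -> discriminates f n m -> discriminates (p%:Z *: f) n (p * m).
Proof.
move=> p_gt0 /andP[m_gt0 f_uniq]; rewrite /discriminates muln_gt0 p_gt0 m_gt0 /=.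
have p_inj : injective ( *%R p%:Z) by apply: mulfI; rewrite eqz_nat -lt0n.
rewrite -(map_inj_uniq p_inj) -map_comp in f_uniq.
congr (uniq _): f_uniq; apply: eq_map => i /=.
by rewrite hornerZ PoszM -mulz_modr.
Qed.

Lemma discriminator_le (g : {poly int}) (n m : nat) :
  discriminates g n m -> (discriminator g n <= (m%:Z)%:E)%E.
Proof.
move=> gm; rewrite /discriminator; case: pselect => [ex_m|[]]; last by exists m.
by case: ex_minnP => k _ /(_ m gm); rewrite lee_fin lez_nat.
Qed.

(** Serves the larger side of an inequality, where attainment suffices; minimality enters through
    [discriminator_le]. *)
Variant discriminator_spec (g : {poly int}) (n : nat) : \bar int -> Prop :=
  | DiscriminatorFin m of discriminates g n m :
      discriminator_spec g n (m%:Z)%:E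
  | DiscriminatorInf : discriminator_spec g n +oo%E.

Lemma discriminatorP (g : {poly int}) (n : nat) :
  discriminator_spec g n (discriminator g n).
Proof.
rewrite /discriminator; case: pselect => [ex_m|_]; last by constructor.
by case: ex_minnP => m gm _; constructor.
Qed.

Theorem theorem4 (p : nat) (f : {poly int}) (n : nat)
    (p_prime : prime p) (n_gt0 : (0 < n)%N) :
  (discriminator f n <= discriminator (p%:Z *: f) n)%E /\
  (discriminator (p%:Z *: f) n <= (p%:Z)%:E * discriminator f n)%E.
Proof.
have p_gt0 := prime_gt0 p_prime; split.
- case: (discriminatorP (p%:Z *: f) n) => [m pf_m|]; last exact: leey.
  exact/discriminator_le/(discriminates_unscale pf_m).
- case: (discriminatorP f n) => [m f_m|].
    by rewrite -EFinM -PoszM; apply/discriminator_le/discriminates_scale.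
  (* Here the bound is [p * +oo], which is [+oo] because [p] is positive. *)
  by rewrite gt0_muley ?leey // lte_fin ltz_nat.
Qed.
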